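(* 1. Let $\pi\in\mathbb{H}_2$ with $\det\pi\ne0$, and write its associated symmetric $2\times2$ matrix as $[\pi]=U^{\mathrm T}\begin{pmatrix}\lambda_1&0\\0&\lambda_2\end{pmatrix}U$ with $U$ orthogonal and $\lambda_1,\lambda_2\in\mathbb{R}$. Then an ellipse of maximal area inscribed in $\Lambda_\pi$ is defined by the matrix $$h_\pi=U^{\mathrm T}\begin{pmatrix}|\lambda_1|&0\\0&|\lambda_2|\end{pmatrix}U.$$ 2. Let $\pi\in\mathbb{H}_3$ with $\mathrm{disc}\,\pi>0$, let $\phi_\pi$ be a $2\times2$ real matrix such that $\pi\circ\phi_\pi=x(x^2-3y^2)$, and define $h_\pi=(\phi_\pi^{-1})^{\mathrm T}\phi_\pi^{-1}$. Then $h_\pi$ defines an ellipse of maximal area inscribed in $\Lambda_\pi$. Moreover $\det h_\pi=\frac{2^{-2/3}}3(\mathrm{disc}\,\pi)^{1/3}$. 3. Let $\pi\in\mathbb{H}_3$ with $\mathrm{disc}\,\pi<0$, let $\phi_\pi$ be a $2\times2$ real matrix such that $\pi\circ\phi_\pi=x(x^2+3y^2)$, and define $h_\pi=2^{1/3}(\phi_\pi^{-1})^{\mathrm T}\phi_\pi^{-1}$. Then $h_\pi$ defines an ellipse of maximal area inscribed in $\Lambda_\pi$. Moreover $\det h_\pi=\frac13|\mathrm{disc}\,\pi|^{1/3}$.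
   Context: $\mathbb{H}_m$ is the space of real homogeneous polynomials of degree $m$ in $(x,y)$. For $\pi\in\mathbb{H}_m$, $\Lambda_\pi:=\{z\in\mathbb{R}^2:|\pi(z)|\le1\}$. Ellipses are filled and centered at $0$; the ellipse defined by a symmetric positive definite $2\times2$ matrix $h$ is $\{z\in\mathbb{R}^2:\langle hz,z\rangle\le1\}$. ''Inscribed in $\Lambda_\pi$'' means contained in $\Lambda_\pi$, and ''maximal'' means of largest area among all ellipses centered at $0$ contained in $\Lambda_\pi$. For $\pi\in\mathbb{H}_2$, $[\pi]$ is the symmetric matrix with $\pi(z)=\langle[\pi]z,z\rangle$; $\det(ax^2+2bxy+cy^2)=ac-b^2$. For cubics, $\mathrm{disc}(ax^3+bx^2y+cxy^2+dy^3)=b^2c^2-4ac^3-4b^3d+18abcd-27a^2d^2$. Matrices $\phi_\pi$ as in 2 and 3 always exist and are invertible. *)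

(* Defs.v *)
From HB Require Import structures.
From mathcomp Require Import all_boot all_order all_algebra.
From mathcomp Require Import all_classical all_reals all_analysis.
From mathcomp Require Import ring.
From mathcomp Require mpoly.
(* The notations of [mpoly] clash with those of MathComp-Analysis. *)
Import -(notations) mpoly.

Set Implicit Arguments.
Unset Strict Implicit.
Unset Printing Implicit Defensive.
Import Order.TTheory GRing.Theory Num.Theory.
Import numFieldNormedType.Exports.

Local Open Scope classical_set_scope.
Local Open Scope ring_scope.

(* Real polynomials in the two variables (x, y). *)
Notation bipoly R := (mpoly.mpoly 2 R).

(* The space H_m, containing the zero polynomial for every m. *)
Definition Hpoly (R : realType) (m : nat) : {pred bipoly R} :=
  fun p => p \is ishomog1 m mdeg.
Arguments Hpoly R m : clear implicits.

Section Defs.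
Variable R : realType.

(* Coefficient of x^i y^j; see [pevalE] below. *)
Definition coefxy (p : bipoly R) (i j : nat) : R :=
  mcoeff (Multinom [tuple i; j]) p.

(* Planar sets live in [R * R], which carries the product measure;
   [vec] sends a point to the corresponding column vector. *)
Definition vec (z : R * R) : 'cV[R]_2 :=
  \col_(i < 2) (if i == ord0 then z.1 else z.2).

Definition peval (p : bipoly R) (v : 'cV[R]_2) : R :=
  meval (fun i => v i ord0) p.

Definition dot (u v : 'cV[R]_2) : R := (u^T *m v) ord0 ord0.

Definition area (A : set (R * R)) : \bar R :=
  (@lebesgue_measure R \x @lebesgue_measure R)%E A.

Definition Lambda (p : bipoly R) : set (R * R) :=
  [set z | `|peval p (vec z)| <= 1].

Definition mx22 (a b c d : R) : 'M[R]_2 :=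
  \matrix_(i < 2, j < 2)
    (if i == ord0 then (if j == ord0 then a else b)
                  else (if j == ord0 then c else d)).

(* For p = a x^2 + 2 b x y + c y^2, so that b is half the coefficient of x y;
   see [quad_mxE] and [det_quad_mx] below. *)
Definition quad_mx (p : bipoly R) : 'M[R]_2 :=
  mx22 (coefxy p 2 0) (coefxy p 1 1 / 2)
       (coefxy p 1 1 / 2) (coefxy p 0 2).

Definition quad_det (p : bipoly R) : R :=
  coefxy p 2 0 * coefxy p 0 2 - (coefxy p 1 1 / 2) ^+ 2.

Definition disc (p : bipoly R) : R :=
  let a := coefxy p 3 0 in let b := coefxy p 2 1 in
  let c := coefxy p 1 2 in let d := coefxy p 0 3 in
  b ^+ 2 * c ^+ 2 - 4 * a * c ^+ 3 - 4 * b ^+ 3 * d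
  + 18 * a * b * c * d - 27 * a ^+ 2 * d ^+ 2.

Definition sym_posdef (h : 'M[R]_2) : Prop :=
  h^T = h /\ forall v : 'cV[R]_2, v != 0 -> 0 < dot (h *m v) v.

Definition ellipse (h : 'M[R]_2) : set (R * R) :=
  [set z | dot (h *m vec z) (vec z) <= 1].

Definition defines_max_ellipse (h : 'M[R]_2) (L : set (R * R)) : Prop :=
  [/\ sym_posdef h,
      ellipse h `<=` L &
      forall h' : 'M[R]_2, sym_posdef h' -> ellipse h' `<=` L ->
        (area (ellipse h') <= area (ellipse h))%E].

End Defs.

Lemma pevalE (R : realType) m (p : bipoly R) (v : 'cV[R]_2) : p \in Hpoly R m ->
  peval p v = \sum_(i < m.+1) coefxy p i (m - i) *
    (v ord0 ord0 ^+ i * v (lift ord0 ord0) ord0 ^+ (m - i)).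
Proof.
move=> /dhomogP hp.
have E (mm : multinom 2) : Multinom [tuple mm ord0; mm (lift ord0 ord0)] = mm.
  apply/mnmP => i; case: i => [[|[|//]] hi];
    rewrite multinomE (tnth_nth 0%N) /=; congr (mm _); exact: val_inj.
rewrite /peval mevalE.
pose f (i : 'I_m.+1) : multinom 2 := Multinom [tuple (i : nat); (m - i)%N].
have fi : injective f.
  by move=> i j /mnmP /(_ ord0); rewrite !multinomE !(tnth_nth 0%N) /= => /val_inj.
transitivity (\sum_(mm <- [seq f i | i <- enum 'I_m.+1])
   mcoeff mm p * \prod_i v i ord0 ^+ mm i).
  rewrite [RHS](bigID (fun mm => mm \in msupp p)) /= [X in _ = _ + X]big1 ?addr0; last first.
    by move=> mm H; rewrite (memN_msupp_eq0 H) mul0r.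
  rewrite -[RHS]big_filter; apply: perm_big; apply: uniq_perm.
  - exact: msupp_uniq.
  - by rewrite filter_uniq // map_inj_uniq // enum_uniq.
  move=> mm; rewrite mem_filter; case: (boolP (mm \in msupp p)) => //= Hm; symmetry.
  have := hp _ Hm; rewrite /= mdegE big_ord_recl big_ord1 => dm.
  have lt : (mm ord0 < m.+1)%N by rewrite ltnS -dm leq_addr.
  apply/mapP; exists (Ordinal lt); first by rewrite mem_enum.
  by rewrite /f /= -dm addKn E.
rewrite big_map big_enum /=; apply: eq_bigr => i _.
by rewrite big_ord_recl big_ord1 /coefxy !multinomE !(tnth_nth 0%N) /=.
Qed.

Lemma quad_mxE (R : realType) (p : bipoly R) (v : 'cV[R]_2) : p \in Hpoly R 2 ->
  (quad_mx p)^T = quad_mx p /\ dot (quad_mx p *m v) v = peval p v.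
Proof.
move=> hp; split.
  by apply/matrixP => i j; rewrite !mxE; case: ifP; case: ifP.
rewrite (@pevalE _ 2 _ _ hp) /dot !big_ord_recl big_ord0 /=.
rewrite !mxE big_ord_recl big_ord1 !mxE !big_ord_recl !big_ord0 !mxE /=.
by field.
Qed.

Lemma det_quad_mx (R : realType) (p : bipoly R) : \det (quad_mx p) = quad_det p.
Proof. rewrite (expand_det_row _ ord0) !big_ord_recl big_ord0 /cofactor !det_mx11 !mxE /= /quad_det /bump /=; ring. Qed.

(* Main.v *)
Require Import Defs.
From mathcomp Require Import all_boot all_order all_algebra.
From mathcomp Require Import all_classical all_reals all_analysis.
From mathcomp Require Import measurable_realfun ring lra.
Import Order.TTheory GRing.Theory Num.Theory.
Local Open Scope ring_scope.

(** The area of an ellipse depends only on the determinant of its matrix (by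
    Cavalieri's principle it is invariant under shears in both directions, and
    these generate SL_2) and decreases with it, so maximality amounts to a lower
    bound on [\det h'] for every ellipse contained in [Lambda p]. Composing [p]
    with a linear map sending the unit disc onto that ellipse, of determinant
    [delta] with [delta^2 \det h' = 1], gives a form [g] with [|g| <= 1] on the
    unit circle, whose discriminant is [disc p * delta^6] (resp. whose
    determinant is [quad_det p * delta^2]). It remains to bound these invariants
    of [g]. For a cubic, write [g = Re (al z^3 + be z)] on the circle; with
    [rho = |al|] and [sig = |be|],
      disc g = 4 (27 rho^4 - 18 rho^2 sig^2 + 8 Re (al conj(be)^3) - sig^4).
    Averaging [g] over the rotations of order 3 gives [rho <= 1], whence
    [disc g <= 108]; evaluating [g] at two orthogonal unit vectors gives
    [(rho + sig)^2 <= 2], whence [disc g >= -27]. The normal forms reach these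
    bounds. *)

Set Implicit Arguments.
Unset Strict Implicit.
Unset Printing Implicit Defensive.

(** * Areas of ellipses *)

Section Area.
Local Open Scope classical_set_scope.
Variable R : realType.
Local Notation mu := (@lebesgue_measure R).

(** With the cross coefficient written [2 * b], the determinant of the quadratic form is
    [a * c - b ^+ 2]. *)
Definition conic (a b c : R) : set (R * R) :=
  [set z | a * z.1 ^+ 2 + 2 * b * (z.1 * z.2) + c * z.2 ^+ 2 <= 1].

Lemma measurable_conic (a b c : R) : measurable (conic a b c).
Proof.
rewrite /conic -[X in measurable X]setTI.
have mf : measurable_fun setT (fun z : R * R =>
    a * z.1 ^+ 2 + 2 * b * (z.1 * z.2) + c * z.2 ^+ 2).
  have m1 : measurable_fun [set: R * R] fst by exact: measurable_fst.
  have m2 : measurable_fun [set: R * R] snd by exact: measurable_snd.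
  apply: measurable_funD; last first.
    by apply: measurable_funM => //; apply: measurable_funX.
  apply: measurable_funD; last first.
    by apply: measurable_funM => //; apply: measurable_funM.
  by apply: measurable_funM => //; apply: measurable_funX.
have := mf measurableT `]-oo, 1]%classic (measurable_itv _).
by congr (measurable (_ `&` _)); apply/seteqP; split=> z /=; rewrite in_itv.
Qed.

(** Both sets are empty for [k < 0], and otherwise are closed intervals of half-length
    [Num.sqrt (k / c)]. *)
Lemma lebesgue_measure_sqr_le (c t k : R) : 0 < c ->
  mu [set y | c * (y + t) ^+ 2 <= k] = mu [set y | c * y ^+ 2 <= k].
Proof.
move=> c0; have [k0|k0] := ltP k 0.
  have E s : [set y | c * (y + s) ^+ 2 <= k] = set0.
    rewrite -subset0 => y /= /(fun H => le_lt_trans H k0).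
    by rewrite ltNge mulr_ge0 ?sqr_ge0 // ltW.
  rewrite E -(E 0); congr (mu _).
  by apply/seteqP; split=> y /=; rewrite addr0.
have E s : [set y | c * (y + s) ^+ 2 <= k] =
    `[- s - Num.sqrt (k / c), - s + Num.sqrt (k / c)]%classic.
  have kc : 0 <= k / c by rewrite divr_ge0 // ltW.
  apply/seteqP; split=> y /=; rewrite in_itv /= (mulrC c) -ler_pdivlMr //.
    by move=> /ler_wsqrtr; rewrite sqrtr_sqr ler_norml => /andP[? ?]; lra.
  move=> ?; rewrite -(sqr_sqrtr kc) -[leLHS]real_normK ?num_real //.
  by rewrite ler_sqr ?nnegrE // ler_norml; lra.
have -> : [set y | c * y ^+ 2 <= k] = [set y | c * (y + 0) ^+ 2 <= k].
  by apply/seteqP; split=> y /=; rewrite addr0.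
rewrite !E !lebesgue_measure_itv /= !lte_fin.
have -> : (- t - Num.sqrt (k / c) < - t + Num.sqrt (k / c)) =
    (- 0 - Num.sqrt (k / c) < - 0 + Num.sqrt (k / c)).
  by rewrite ltrD2l -(ltrD2l (- 0)).
by case: ifP => // _; rewrite -!EFinB; congr (_%:E); ring.
Qed.

(* Cavalieri: a shear translates each vertical section. *)
Lemma area_conic_shear (a b c a' b' : R) : 0 < c ->
  a * c - b ^+ 2 = a' * c - b' ^+ 2 ->
  area (conic a b c) = area (conic a' b' c).
Proof.
move=> c0 eD; rewrite /area /product_measure1; apply: eq_integral => x _ /=.
have E u v : xsection (conic u v c) x =
    [set y | c * (y + v * x / c) ^+ 2 <= 1 - (u * c - v ^+ 2) / c * x ^+ 2].
  apply/seteqP; split=> y /=; rewrite /xsection /= inE /conic /= -subr_ge0 => H;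
    rewrite -subr_ge0; move: H; congr (is_true (0 <= _)); field; lra.
by rewrite !E eD !lebesgue_measure_sqr_le.
Qed.

(** By uniqueness of the product measure, the area is also the integral over horizontal sections;
    this brings horizontal shears within reach of [area_conic_shear]. *)
Lemma area_conic_swap (a b c : R) : area (conic a b c) = area (conic c b a).
Proof.
have -> : area (conic a b c) = (mu \x^ mu)%E (conic a b c).
  rewrite /area.
  apply: product_measure_unique => /=; last exact: measurable_conic.
  by move=> ? ? ? ?; rewrite product_measure2E.
rewrite /area /product_measure1 /product_measure2.
apply: eq_integral => x _ /=; congr (mu _).
apply/seteqP; split=> y /=; rewrite /xsection /ysection /= !inE /conic /=;
  by rewrite (mulrC y) => H; apply: le_trans H; lra.
Qed.

Lemma area_conic_det_aux (a b c a' b' c' : R) : 0 < c -> c <= c' ->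
  0 < a * c - b ^+ 2 -> a * c - b ^+ 2 = a' * c' - b' ^+ 2 ->
  area (conic a b c) = area (conic a' b' c').
Proof.
move=> c0 cc' D0 eD; have c'0 := lt_le_trans c0 cc'.
set D := a * c - b ^+ 2 in D0 eD.
(* The conics [(a1, 0, c)] and [(a1, b1, c')] are related by a horizontal shear;
   such a [b1] exists because [c <= c']. *)
pose a1 := D / c; pose b1 := Num.sqrt (a1 * (c' - c)).
have a10 : 0 < a1 by exact: divr_gt0.
have Eb : b1 ^+ 2 = a1 * (c' - c) by rewrite sqr_sqrtr // mulr_ge0 ?subr_ge0 // ltW.
have eD1 : D = a1 * c by rewrite /a1; field; lra.
rewrite (@area_conic_shear a b c a1 0) ?expr0n ?subr0 //.
rewrite area_conic_swap (@area_conic_shear c 0 a1 c' b1) //; last first.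
  by rewrite Eb; ring.
rewrite area_conic_swap (@area_conic_shear a1 b1 c' a' b') //.
by rewrite -eD Eb eD1; ring.
Qed.

Lemma area_conic_det (a b c a' b' c' : R) : 0 < c -> 0 < c' ->
  0 < a * c - b ^+ 2 -> a * c - b ^+ 2 = a' * c' - b' ^+ 2 ->
  area (conic a b c) = area (conic a' b' c').
Proof.
move=> c0 c'0 D0 eD; have [cc'|/ltW cc'] := leP c c'.
  exact: area_conic_det_aux.
by apply/esym; apply: area_conic_det_aux; rewrite // -eD.
Qed.

(** Both conics are first made axis-parallel with the same coefficient [c'] of [y^2]; they are then
    nested, the one of larger determinant inside. *)
Lemma le_area_conic (a b c a' b' c' : R) : 0 < c -> 0 < c' ->
  0 < a * c - b ^+ 2 -> a * c - b ^+ 2 <= a' * c' - b' ^+ 2 ->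
  (area (conic a' b' c') <= area (conic a b c))%E.
Proof.
move=> c0 c'0 D0 leD; set D := a * c - b ^+ 2 in D0 leD.
set D' := a' * c' - b' ^+ 2 in leD.
rewrite (@area_conic_det a' b' c' (D' / c') 0 c') //; last 2 first.
  exact: lt_le_trans leD.
  by rewrite -/D'; field; lra.
rewrite (@area_conic_det a b c (D / c') 0 c') //; last by rewrite -/D; field; lra.
apply: le_measure; rewrite ?inE; try exact: measurable_conic.
move=> z; rewrite /conic /=; apply: le_trans; rewrite !lerD2r.
by rewrite ler_wpM2r ?sqr_ge0 // ler_wpM2r // invr_ge0 ltW.
Qed.

End Area.

(** * Binary forms on the unit circle *)

Section Forms.
Variable R : realType.

Lemma polar_angle (p q : R) : exists t : R,
  p = Num.sqrt (p ^+ 2 + q ^+ 2) * cos t /\ q = Num.sqrt (p ^+ 2 + q ^+ 2) * sin t.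
Proof.
set r := Num.sqrt _.
have r2 : r ^+ 2 = p ^+ 2 + q ^+ 2 by rewrite sqr_sqrtr // addr_ge0 ?sqr_ge0.
have [r0|r0] := eqVneq r 0.
  exists 0; rewrite r0 !mul0r; move: r2; rewrite r0 expr0n /= => /esym/eqP.
  by rewrite paddr_eq0 ?sqr_ge0 // !sqrf_eq0 => /andP[/eqP-> /eqP->].
have rp : 0 < r by rewrite lt_def r0 sqrtr_ge0.
have pr : `|p / r| <= 1.
  rewrite -ler_sqr ?nnegrE // real_normK ?num_real // expr1n expr_div_n.
  by rewrite ler_pdivrMr ?exprn_gt0 // mul1r r2 lerDl sqr_ge0.
have pr' : p / r \in `[-1, 1] by rewrite in_itv /= -ler_norml.
have cK := acosK pr'.
have ep : p = r * cos (acos (p / r)) by rewrite cK; field.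
have eq : `|q| = r * sin (acos (p / r)).
  rewrite sin_acos -?ler_norml //.
  have -> : 1 - (p / r) ^+ 2 = (q / r) ^+ 2.
    rewrite !expr_div_n; apply: (mulIf (expf_neq0 2 r0)).
    by rewrite mulrBl !divfK ?expf_neq0 // r2; ring.
  by rewrite sqrtr_sqr normrM normfV (gtr0_norm rp); field.
have [q0|q0] := leP 0 q.
  by exists (acos (p / r)); split=> //; rewrite -eq ger0_norm.
exists (- acos (p / r)); rewrite cosN sinN; split => //.
by rewrite mulrN -eq ltr0_norm // opprK.
Qed.

Lemma cos2x (t : R) : cos (2 * t) = cos t ^+ 2 - sin t ^+ 2.
Proof. by rewrite mulrDl mul1r cosD. Qed.

Lemma sin2x (t : R) : sin (2 * t) = 2 * (sin t * cos t).
Proof. by rewrite mulrDl mul1r sinD; ring. Qed.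

Lemma cos3x (t : R) : cos (3 * t) = cos t ^+ 3 - 3 * (cos t * sin t ^+ 2).
Proof.
have -> : 3 * t = 2 * t + t by ring.
by rewrite cosD cos2x sin2x; ring.
Qed.

Lemma sin3x (t : R) : sin (3 * t) = 3 * (cos t ^+ 2 * sin t) - sin t ^+ 3.
Proof.
have -> : 3 * t = 2 * t + t by ring.
by rewrite sinD cos2x sin2x; ring.
Qed.

Definition qform (a b c x y : R) := a * x ^+ 2 + 2 * b * (x * y) + c * y ^+ 2.

Definition cform (a b c d x y : R) :=
  a * x ^+ 3 + b * (x ^+ 2 * y) + c * (x * y ^+ 2) + d * y ^+ 3.

Definition cdisc (a b c d : R) :=
  b ^+ 2 * c ^+ 2 - 4 * a * c ^+ 3 - 4 * b ^+ 3 * d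
  + 18 * a * b * c * d - 27 * a ^+ 2 * d ^+ 2.

(** The determinant is the product of the eigenvalues [(a + c) / 2 + r] and [(a + c) / 2 - r], which
    are values of the form at orthogonal unit eigenvectors. *)
Lemma qform_circle_det (a b c : R) :
  (forall x y, x ^+ 2 + y ^+ 2 = 1 -> `|qform a b c x y| <= 1) ->
  `|a * c - b ^+ 2| <= 1.
Proof.
move=> H.
(* The angle [t] of the traceless part is twice that of the eigenvector [(u, v)]. *)
have [t [et1 et2]] := polar_angle ((a - c) / 2) b.
move: et1 et2; set r := Num.sqrt _ => et1 et2.
have r2 : r ^+ 2 = ((a - c) / 2) ^+ 2 + b ^+ 2.
  by rewrite sqr_sqrtr // addr_ge0 ?sqr_ge0.
have r0 : 0 <= r by exact: sqrtr_ge0.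
have cs := cos2Dsin2 (t / 2).
have t2 : t = 2 * (t / 2) by field.
rewrite t2 cos2x in et1; rewrite t2 sin2x in et2.
set u := cos _ in cs et1 et2; set v := sin _ in cs et1 et2.
have := H u v cs; have := H (- v) u; rewrite !ler_norml sqrrN addrC => /(_ cs).
have -> : qform a b c u v = (a + c) / 2 + r.
  rewrite /qform.
  have -> : a * u ^+ 2 + 2 * b * (u * v) + c * v ^+ 2 =
      (a + c) / 2 * (u ^+ 2 + v ^+ 2) +
      (a - c) / 2 * (u ^+ 2 - v ^+ 2) + 2 * b * (u * v) by field.
  rewrite et1 et2 cs.
  transitivity ((a + c) / 2 + r * (u ^+ 2 + v ^+ 2) ^+ 2); first by ring.
  by rewrite cs; ring.
have -> : qform a b c (- v) u = (a + c) / 2 - r.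
  rewrite /qform.
  have -> : a * (- v) ^+ 2 + 2 * b * (- v * u) + c * u ^+ 2 =
      (a + c) / 2 * (u ^+ 2 + v ^+ 2) -
      (a - c) / 2 * (u ^+ 2 - v ^+ 2) - 2 * b * (u * v) by field.
  rewrite et1 et2 cs.
  transitivity ((a + c) / 2 - r * (u ^+ 2 + v ^+ 2) ^+ 2); first by ring.
  by rewrite cs; ring.
have -> : a * c - b ^+ 2 = ((a + c) / 2) ^+ 2 - r ^+ 2 by rewrite r2; field.
by move=> /andP[? ?] /andP[? ?]; apply/andP; split; nra.
Qed.

(* On the unit circle [z = u + i v] a cubic form is [Re (al z^3 + be z)], where
   [al = (p, q)] and [be = (r, s)]. *)
Lemma cform_disc_bounds (a b c d : R) :
  (forall x y, x ^+ 2 + y ^+ 2 = 1 -> `|cform a b c d x y| <= 1) ->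
  - 27 <= cdisc a b c d <= 108.
Proof.
move=> H.
(* These solve the equations [ea] to [ed], obtained by expanding [Re (al z^3 + be z |z|^2)]. *)
pose p := (a - c) / 4; pose q := (d - b) / 4.
pose r := (3 * a + c) / 4; pose s := - (b + 3 * d) / 4.
have ea : a = p + r by rewrite /p /r; field.
have eb : b = - 3 * q - s by rewrite /q /s; field.
have ec : c = r - 3 * p by rewrite /p /r; field.
have ed : d = q - s by rewrite /q /s; field.
move: p q r s ea eb ec ed => p q r s ea eb ec ed.
pose rho := Num.sqrt (p ^+ 2 + q ^+ 2); pose sig := Num.sqrt (r ^+ 2 + s ^+ 2).
have rho0 : 0 <= rho by exact: sqrtr_ge0.
have sig0 : 0 <= sig by exact: sqrtr_ge0.
have rho2 : rho ^+ 2 = p ^+ 2 + q ^+ 2 by rewrite sqr_sqrtr // addr_ge0 ?sqr_ge0.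
have sig2 : sig ^+ 2 = r ^+ 2 + s ^+ 2 by rewrite sqr_sqrtr // addr_ge0 ?sqr_ge0.
(* [W] is [Re (al conj(be)^3)]; in the bound [leW] the difference of squares is the square of the
   imaginary part. *)
pose W := p * (r ^+ 3 - 3 * (r * s ^+ 2)) + q * (3 * (r ^+ 2 * s) - s ^+ 3).
have eD : cdisc a b c d =
    4 * (27 * rho ^+ 4 - 18 * (rho ^+ 2 * sig ^+ 2) + 8 * W - sig ^+ 4).
  by rewrite (exprM rho 2 2) (exprM sig 2 2) rho2 sig2 /cdisc /W ea eb ec ed; ring.
have leW : `|W| <= rho * sig ^+ 3.
  rewrite -ler_sqr ?nnegrE ?mulr_ge0 ?exprn_ge0 // real_normK ?num_real //.
  rewrite exprMn -exprM mulnC exprM rho2 sig2 -subr_ge0.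
  have -> : (p ^+ 2 + q ^+ 2) * (r ^+ 2 + s ^+ 2) ^+ 3 - W ^+ 2 =
    (p * (3 * (r ^+ 2 * s) - s ^+ 3) - q * (r ^+ 3 - 3 * (r * s ^+ 2))) ^+ 2.
    by rewrite /W; ring.
  exact: sqr_ge0.
(* Averaging over the rotations by multiples of [2 pi / 3] isolates [al z^3]. *)
have rho1 : rho <= 1.
  have [t [ep eq]] := polar_angle p q; rewrite -/rho in ep eq.
  have cs := cos2Dsin2 (t / 3).
  have t3 : t = 3 * (t / 3) by field.
  rewrite t3 cos3x in ep; rewrite t3 sin3x in eq.
  move: (cos _) (sin _) cs ep eq => u v cs ep eq.
  pose k : R := Num.sqrt 3.
  have k2 : k ^+ 2 = 3 by rewrite sqr_sqrtr.
  (* The points are [z = exp (- i t / 3)], where [al z^3 = rho], and its two rotations; the three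
     terms [be z] sum to zero. *)
  have H1 : `|cform a b c d u (- v)| <= 1 by apply: H; rewrite sqrrN.
  have H2 : `|cform a b c d (- u / 2 + k * (v / 2)) (v / 2 + k * (u / 2))| <= 1.
    apply: H; transitivity ((1 + k ^+ 2) / 4 * (u ^+ 2 + v ^+ 2)); first by field.
    by rewrite k2 cs; field.
  have H3 : `|cform a b c d (- u / 2 - k * (v / 2)) (v / 2 - k * (u / 2))| <= 1.
    apply: H; transitivity ((1 + k ^+ 2) / 4 * (u ^+ 2 + v ^+ 2)); first by field.
    by rewrite k2 cs; field.
  have E : cform a b c d u (- v) +
      (cform a b c d (- u / 2 + k * (v / 2)) (v / 2 + k * (u / 2)) +
      cform a b c d (- u / 2 - k * (v / 2)) (v / 2 - k * (u / 2))) = 3 * rho.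
    (* Adding the two conjugates in [k] leaves only even powers, so that [k ^+ 2 = 3] eliminates the
       root. *)
    have E2 x y x' y' : cform a b c d (x + k * x') (y + k * y') +
        cform a b c d (x - k * x') (y - k * y') = 2 * cform a b c d x y +
        2 * k ^+ 2 * (3 * a * x * x' ^+ 2 + b * (2 * x * x' * y' + y * x' ^+ 2)
          + c * (2 * y * x' * y' + x * y' ^+ 2) + 3 * d * y * y' ^+ 2).
      by rewrite /cform; ring.
    transitivity (3 * rho * (u ^+ 2 + v ^+ 2) ^+ 3); last by rewrite cs; ring.
    by rewrite E2 k2 /cform ea eb ec ed ep eq; field.
  by move: H1 H2 H3; rewrite !ler_norml => /andP[_ ?] /andP[_ ?] /andP[_ ?]; lra.
(* At two orthogonal unit vectors, the squares of the values sum to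
   [|al|^2 + |be|^2 + 2 Re (al be z^4)]. *)
have rs2 : (rho + sig) ^+ 2 <= 2.
  (* Here [t] is an argument of [al be]; at [z = exp (- i t / 4)] and [i z] the sum of squares
     becomes [(rho + sig)^2]. *)
  have [t [ep eq]] := polar_angle (p * r - q * s) (p * s + q * r).
  have er : Num.sqrt ((p * r - q * s) ^+ 2 + (p * s + q * r) ^+ 2) = rho * sig.
    rewrite -sqrtrM ?addr_ge0 ?sqr_ge0 //; congr Num.sqrt; ring.
  rewrite er in ep eq.
  have cs := cos2Dsin2 (t / 4).
  have t4 : t = 2 * (2 * (t / 4)) by field.
  rewrite t4 cos2x !sin2x !cos2x in ep; rewrite t4 sin2x sin2x cos2x in eq.
  move: (cos _) (sin _) cs ep eq => u v cs ep eq.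
  have H1 : `|cform a b c d u (- v)| <= 1 by apply: H; rewrite sqrrN.
  have H2 : `|cform a b c d v u| <= 1 by apply: H; rewrite addrC.
  have E : cform a b c d u (- v) ^+ 2 + cform a b c d v u ^+ 2 = (rho + sig) ^+ 2.
    transitivity ((rho ^+ 2 + sig ^+ 2) * (u ^+ 2 + v ^+ 2) ^+ 3 +
      2 * (u ^+ 2 + v ^+ 2) *
      ((p * r - q * s) * (u ^+ 4 - 6 * (u ^+ 2 * v ^+ 2) + v ^+ 4)
       + (p * s + q * r) * (4 * (u ^+ 3 * v) - 4 * (u * v ^+ 3)))).
      by rewrite rho2 sig2 /cform ea eb ec ed; ring.
    rewrite ep eq cs.
    transitivity (rho ^+ 2 + sig ^+ 2 + 2 * (rho * sig) * (u ^+ 2 + v ^+ 2) ^+ 4).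
      by ring.
    by rewrite cs; ring.
  have sq x : `|x| <= 1 -> x ^+ 2 <= 1 :> R.
    by move=> ?; rewrite -real_normK ?num_real // exprn_ile1.
  by rewrite -E; have := sq _ H1; have := sq _ H2; lra.
move: leW; rewrite eD ler_norml => /andP[W1 W2]; apply/andP; split.
  (* Since [W >= - rho sig^3], the discriminant is at least [- 4 (sig - rho) (3 rho + sig)^3]. Its
     comparison with [27 (rho + sig)^4] has a double zero at [sig = 3 rho], the ratio for
     [x (x^2 + 3 y^2)]. *)
  have h1 : (rho + sig) ^+ 4 <= 4.
    rewrite (exprM _ 2 2) (_ : 4 = 2 ^+ 2); last by ring.
    by rewrite ler_sqr // nnegrE // sqr_ge0.
  have : 0 <= (sig - 3 * rho) ^+ 2 *
      (11 * sig ^+ 2 + 46 * (rho * sig) + 51 * rho ^+ 2).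
    by rewrite mulr_ge0 ?sqr_ge0 // !addr_ge0 ?mulr_ge0 ?sqr_ge0.
  have -> : (sig - 3 * rho) ^+ 2 *
      (11 * sig ^+ 2 + 46 * (rho * sig) + 51 * rho ^+ 2) =
    27 * (rho + sig) ^+ 4 - 16 * ((sig - rho) * (3 * rho + sig) ^+ 3) by ring.
  have -> : (sig - rho) * (3 * rho + sig) ^+ 3 =
    sig ^+ 4 + 8 * (rho * sig ^+ 3) + 18 * (rho ^+ 2 * sig ^+ 2) -
    27 * rho ^+ 4 by ring.
  by lra.
(* With [W <= rho sig^3], the terms other than [27 rho^4] contribute at most zero, so the
   discriminant is at most [108 rho^4]. *)
have r4 : rho ^+ 4 <= 1 by exact: exprn_ile1.
have : 0 <= sig ^+ 2 * ((sig - 4 * rho) ^+ 2 + 2 * rho ^+ 2).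
  by rewrite mulr_ge0 ?addr_ge0 ?sqr_ge0 // mulr_ge0 ?sqr_ge0.
have -> : sig ^+ 2 * ((sig - 4 * rho) ^+ 2 + 2 * rho ^+ 2) =
  18 * (rho ^+ 2 * sig ^+ 2) - 8 * (rho * sig ^+ 3) + sig ^+ 4 by ring.
by lra.
Qed.

(** * Linear substitutions in binary forms *)

(** The discriminant of a binary cubic is an invariant of weight 6; the four arguments are the
    coefficients of the composed form, as in [cform_comp]. *)
Lemma cdisc_comp (a b c d m n k l : R) :
  cdisc (cform a b c d m k)
    (3 * a * m ^+ 2 * n + b * (m ^+ 2 * l + 2 * m * n * k)
     + c * (2 * m * k * l + n * k ^+ 2) + 3 * d * k ^+ 2 * l)
    (3 * a * m * n ^+ 2 + b * (2 * m * n * l + n ^+ 2 * k)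
     + c * (m * l ^+ 2 + 2 * n * k * l) + 3 * d * k * l ^+ 2)
    (cform a b c d n l) =
  cdisc a b c d * (m * l - n * k) ^+ 6.
Proof. by rewrite /cdisc /cform; ring. Qed.

Lemma qform_comp (a b c m n k l x y : R) :
  qform a b c (m * x + n * y) (k * x + l * y) =
  qform (qform a b c m k) (a * m * n + b * (m * l + n * k) + c * k * l)
    (qform a b c n l) x y.
Proof. by rewrite /qform; ring. Qed.

Lemma cform_comp (a b c d m n k l x y : R) :
  cform a b c d (m * x + n * y) (k * x + l * y) =
  cform (cform a b c d m k)
    (3 * a * m ^+ 2 * n + b * (m ^+ 2 * l + 2 * m * n * k)
     + c * (2 * m * k * l + n * k ^+ 2) + 3 * d * k ^+ 2 * l)
    (3 * a * m * n ^+ 2 + b * (2 * m * n * l + n ^+ 2 * k)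
     + c * (m * l ^+ 2 + 2 * n * k * l) + 3 * d * k * l ^+ 2)
    (cform a b c d n l) x y.
Proof. by rewrite /cform; ring. Qed.

Lemma qform_comp_circle_det (a b c m n k l : R) :
  (forall x y, x ^+ 2 + y ^+ 2 = 1 ->
    `|qform a b c (m * x + n * y) (k * x + l * y)| <= 1) ->
  `|a * c - b ^+ 2| * (m * l - n * k) ^+ 2 <= 1.
Proof.
move=> H; rewrite -(ger0_norm (sqr_ge0 (_ - _))) -normrM.
have -> : (a * c - b ^+ 2) * (m * l - n * k) ^+ 2 =
    qform a b c m k * qform a b c n l
    - (a * m * n + b * (m * l + n * k) + c * k * l) ^+ 2 by rewrite /qform; ring.
by apply: qform_circle_det => x y xy; rewrite -qform_comp; exact: H.
Qed.

Lemma cform_comp_disc_bounds (a b c d m n k l : R) :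
  (forall x y, x ^+ 2 + y ^+ 2 = 1 ->
    `|cform a b c d (m * x + n * y) (k * x + l * y)| <= 1) ->
  - 27 <= cdisc a b c d * (m * l - n * k) ^+ 6 <= 108.
Proof.
move=> H; rewrite -cdisc_comp.
by apply: cform_disc_bounds => x y xy; rewrite -cform_comp; exact: H.
Qed.

Lemma cform_inj (a b c d a' b' c' d' : R) :
  (forall x y, cform a b c d x y = cform a' b' c' d' x y) ->
  [/\ a = a', b = b', c = c' & d = d'].
Proof.
move=> H; have := H 1 0; have := H 0 1; have := H 1 1; have := H 1 (- 1).
rewrite /cform => H1 H2 H3 H4; split; lra.
Qed.

Lemma cdisc_comp_eq (a b c d a' b' c' d' m n k l : R) :
  (forall x y, cform a b c d (m * x + n * y) (k * x + l * y) =
    cform a' b' c' d' x y) ->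
  cdisc a b c d * (m * l - n * k) ^+ 6 = cdisc a' b' c' d'.
Proof.
move=> H; rewrite -cdisc_comp.
have [-> -> -> -> //] := cform_inj
  (fun x y => etrans (esym (cform_comp a b c d m n k l x y)) (H x y)).
Qed.

End Forms.

(** * Inscribed ellipses *)

Section Ellipses.
Local Open Scope classical_set_scope.
Variable R : realType.
Local Notation i0 := (ord0 : 'I_2).
Local Notation i1 := (lift ord0 ord0 : 'I_2).

Lemma mulmx_vec (A : 'M[R]_2) (x y : R) :
  A *m vec (x, y) = vec (A i0 i0 * x + A i0 i1 * y, A i1 i0 * x + A i1 i1 * y).
Proof.
apply/matrixP => i j; rewrite !mxE !big_ord_recl big_ord0 !mxE /= addr0.
case: (unliftP ord0 i) => [k ->|->] //=.
by rewrite !(ord1 k).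
Qed.

Lemma vec_surj (v : 'cV[R]_2) : v = vec (v i0 ord0, v i1 ord0).
Proof.
apply/matrixP => i j; rewrite !mxE !(ord1 j) /=.
by case: (unliftP ord0 i) => [k ->|->] //=; rewrite !(ord1 k).
Qed.

Lemma dot_vec (x y z t : R) : dot (vec (x, y)) (vec (z, t)) = x * z + y * t.
Proof. by rewrite /dot !mxE !big_ord_recl big_ord0 !mxE /= addr0. Qed.

Lemma det2 (A : 'M[R]_2) : \det A = A i0 i0 * A i1 i1 - A i0 i1 * A i1 i0.
Proof.
rewrite (expand_det_row _ ord0) !big_ord_recl big_ord0 /cofactor !det_mx11 !mxE /=.
rewrite /bump /= (_ : lift i1 ord0 = i0); last exact: val_inj.
by rewrite ?(_ : lift i0 ord0 = i1); ring.
Qed.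

Lemma sym_posdef_entries (h : 'M[R]_2) : sym_posdef h ->
  [/\ h i1 i0 = h i0 i1, 0 < h i0 i0, 0 < h i1 i1, 0 < \det h &
      ellipse h = conic (h i0 i0) (h i0 i1) (h i1 i1)].
Proof.
move=> [sh ph].
have h10 : h i1 i0 = h i0 i1 by rewrite -{1}sh mxE.
have E x y : dot (h *m vec (x, y)) (vec (x, y)) =
    h i0 i0 * x ^+ 2 + 2 * h i0 i1 * (x * y) + h i1 i1 * y ^+ 2.
  by rewrite mulmx_vec dot_vec h10; ring.
have nz (x y : R) : (x != 0) || (y != 0) -> vec (x, y) != 0.
  apply: contraTneq => /matrixP e; have := e i0 ord0; have := e i1 ord0.
  by rewrite !mxE /= => -> ->; rewrite eqxx.
have a0 : 0 < h i0 i0.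
  by have := ph _ (nz 1 0 _); rewrite oner_eq0 E => /(_ isT); lra.
have c0 : 0 < h i1 i1.
  by have := ph _ (nz 0 1 _); rewrite oner_eq0 orbT E => /(_ isT); lra.
split=> //.
  (* At this vector the form takes the value [h i0 i0 * \det h]. *)
  have := ph _ (nz (- h i0 i1) (h i0 i0) _); rewrite (gt_eqF a0) orbT E => /(_ isT) h0.
  rewrite det2 h10 -(pmulr_rgt0 _ a0); move: h0; congr (is_true (0 < _)); ring.
by apply/seteqP; split=> -[x y]; rewrite /ellipse /conic /= E.
Qed.

Lemma defines_max_ellipseP (h : 'M[R]_2) (L : set (R * R)) :
  sym_posdef h -> ellipse h `<=` L ->
  (forall h', sym_posdef h' -> ellipse h' `<=` L -> \det h <= \det h') ->
  defines_max_ellipse h L.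
Proof.
move=> sh hL H; split; [exact: sh|exact: hL|move=> h' sh' /(H _ sh')].
have [h10 a0 c0 d0 ->] := sym_posdef_entries sh.
have [h10' a0' c0' _ ->] := sym_posdef_entries sh'.
move: d0; rewrite (det2 h) (det2 h') h10 h10' -(expr2 (h _ _)) -(expr2 (h' _ _)).
exact: le_area_conic.
Qed.

(* The inverse of the Cholesky factor of [h] maps the unit disc onto [ellipse h]. *)
Lemma ellipse_param (h : 'M[R]_2) : sym_posdef h -> exists A : 'M[R]_2,
  \det A ^+ 2 * \det h = 1 /\
  forall x y, x ^+ 2 + y ^+ 2 = 1 ->
    ellipse h (A i0 i0 * x + A i0 i1 * y, A i1 i0 * x + A i1 i1 * y).
Proof.
move=> sh; have [h10 a0 c0 d0 ->] := sym_posdef_entries sh.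
rewrite det2 h10 -expr2 in d0 *.
move: (h i0 i0) (h i0 i1) (h i1 i1) a0 c0 d0 => a b c a0 c0 d0.
pose D := a * c - b ^+ 2; have D0 : 0 < D by [].
(* The Cholesky factor is upper triangular, with diagonal [s], [t] and corner entry [b / s]. *)
pose s := Num.sqrt a; pose t := Num.sqrt (D / a).
have s0 : 0 < s by rewrite sqrtr_gt0.
have t0 : 0 < t by rewrite sqrtr_gt0 divr_gt0.
have s2 : s ^+ 2 = a by rewrite sqr_sqrtr // ltW.
have t2 : t ^+ 2 = D / a by rewrite sqr_sqrtr // ltW // divr_gt0.
exists (mx22 s^-1 (- (b / a) / t) 0 t^-1); split.
  rewrite det2 !mxE /= mulr0 subr0 exprMn !exprVn s2 t2 -/D; field.
  by rewrite !gt_eqF.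
move=> x y xy; rewrite /conic !mxE /= le_eqVlt; apply/orP; left; apply/eqP.
transitivity (a / s ^+ 2 * x ^+ 2 + D / a / t ^+ 2 * y ^+ 2).
  by rewrite /D; field; rewrite !gt_eqF.
rewrite s2 t2 !divff ?gt_eqF ?divr_gt0 // !mul1r; exact: xy.
Qed.

(** Each of the three matrices [h_pi] is treated as such a multiple of a Gram matrix, with [M] the
    inverse of [phi] for cubics. *)
Lemma dot_gram (M : 'M[R]_2) (c : R) (v : 'cV[R]_2) :
  dot ((c *: (M^T *m M)) *m v) v =
  c * (((M *m v) i0 ord0) ^+ 2 + ((M *m v) i1 ord0) ^+ 2).
Proof.
rewrite /dot -scalemxAl linearZ /= -scalemxAl mxE; congr (_ * _).
rewrite -mulmxA trmx_mul trmxK -mulmxA.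
by rewrite mxE !big_ord_recl big_ord0 addr0 mxE [X in _ + X * _ = _]mxE !expr2.
Qed.

Lemma sym_posdef_gram (M : 'M[R]_2) (c : R) : 0 < c -> M \in unitmx ->
  sym_posdef (c *: (M^T *m M)).
Proof.
move=> c0 Mu; split; first by rewrite linearZ /= trmx_mul trmxK.
move=> v v0; rewrite dot_gram pmulr_rgt0 // lt_def addr_ge0 ?sqr_ge0 // andbT.
rewrite paddr_eq0 ?sqr_ge0 // !sqrf_eq0; apply: contra v0 => /andP[/eqP e0 /eqP e1].
rewrite -(mulKmx Mu v) (vec_surj (M *m v)) e0 e1.
have -> : vec (0, 0) = 0 :> 'cV[R]_2.
  by apply/matrixP => i j; rewrite !mxE /=; case: ifP.
by rewrite mulmx0.
Qed.

Lemma ellipse_gramE (M : 'M[R]_2) (c : R) (z : R * R) :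
  ellipse (c *: (M^T *m M)) z ->
  c * (((M *m vec z) i0 ord0) ^+ 2 + ((M *m vec z) i1 ord0) ^+ 2) <= 1.
Proof. by rewrite /ellipse /= dot_gram. Qed.

Lemma det_gram (M : 'M[R]_2) (c : R) :
  \det (c *: (M^T *m M)) = c ^+ 2 * \det M ^+ 2.
Proof. by rewrite detZ det_mulmx det_tr -expr2. Qed.

(** * Determinant bounds for inscribed ellipses *)

Lemma peval_qform (p : bipoly R) (x y : R) : p \in Hpoly R 2 ->
  peval p (vec (x, y)) = qform (coefxy p 2 0) (coefxy p 1 1 / 2) (coefxy p 0 2) x y.
Proof.
move=> hp; rewrite (@pevalE _ 2) // !big_ord_recl big_ord0 /= !mxE /qform /bump /=.
by field.
Qed.

Lemma peval_cform (p : bipoly R) (x y : R) : p \in Hpoly R 3 ->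
  peval p (vec (x, y)) =
  cform (coefxy p 3 0) (coefxy p 2 1) (coefxy p 1 2) (coefxy p 0 3) x y.
Proof.
move=> hp; rewrite (@pevalE _ 3) // !big_ord_recl big_ord0 /= !mxE /cform /bump /=.
by ring.
Qed.

Lemma quad_inscribed_det (p : bipoly R) (h : 'M[R]_2) : p \in Hpoly R 2 ->
  sym_posdef h -> ellipse h `<=` Lambda p -> `|quad_det p| <= \det h.
Proof.
move=> hp sh hL; have [_ _ _ d0 _] := sym_posdef_entries sh.
have [A [dA eA]] := ellipse_param sh.
have A2 : \det A ^+ 2 = (\det h)^-1.
  by apply: (mulIf (lt0r_neq0 d0)); rewrite dA mulVf ?gt_eqF.
have := @qform_comp_circle_det R (coefxy p 2 0) (coefxy p 1 1 / 2) (coefxy p 0 2)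
  (A i0 i0) (A i0 i1) (A i1 i0) (A i1 i1).
rewrite -det2 A2 -/(quad_det p) ler_pdivrMr // mul1r; apply=> x y /eA /hL.
by rewrite /Lambda /= peval_qform.
Qed.

Lemma cubic_inscribed_det (p : bipoly R) (h : 'M[R]_2) : p \in Hpoly R 3 ->
  sym_posdef h -> ellipse h `<=` Lambda p ->
  - 27 * \det h ^+ 3 <= disc p <= 108 * \det h ^+ 3.
Proof.
move=> hp sh hL; have [_ _ _ d0 _] := sym_posdef_entries sh.
have [A [dA eA]] := ellipse_param sh.
have A2 : \det A ^+ 2 = (\det h)^-1.
  by apply: (mulIf (lt0r_neq0 d0)); rewrite dA mulVf ?gt_eqF.
have := @cform_comp_disc_bounds R (coefxy p 3 0) (coefxy p 2 1) (coefxy p 1 2)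
  (coefxy p 0 3) (A i0 i0) (A i0 i1) (A i1 i0) (A i1 i1).
rewrite -det2 (exprM _ 2 3) A2 exprVn -[cdisc _ _ _ _]/(disc p).
rewrite ler_pdivlMr ?exprn_gt0 // ler_pdivrMr ?exprn_gt0 //; apply=> x y /eA /hL.
by rewrite /Lambda /= peval_cform.
Qed.

(** The cubic [x (x^2 + e y^2)] has discriminant [- 4 e^3]; [e = - 3] and [e = 3] give the two
    normal forms. *)
Lemma disc_normal_form (p : bipoly R) (phi : 'M[R]_2) (e : R) : p \in Hpoly R 3 ->
  (forall x y, peval p (phi *m vec (x, y)) = x * (x ^+ 2 + e * y ^+ 2)) ->
  disc p * \det phi ^+ 6 = - 4 * e ^+ 3.
Proof.
move=> hp H; rewrite det2 -[disc p]/(cdisc _ _ _ _).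
rewrite (@cdisc_comp_eq R _ _ _ _ 1 0 e 0) => [|x y]; first by rewrite /cdisc; ring.
by rewrite -peval_cform // -mulmx_vec H /cform; ring.
Qed.

Lemma cube_inj (x y : R) : 0 <= x -> 0 <= y -> x ^+ 3 = y ^+ 3 -> x = y.
Proof. by move=> x0 y0 /eqP; rewrite eqrXn2 // => /eqP. Qed.

Lemma powR13K (x : R) : 0 <= x -> (x `^ (1 / 3)) ^+ 3 = x.
Proof. by move=> x0; rewrite -powR_mulrn ?powR_ge0 // -powRrM divfK ?powRr1. Qed.

(** A singular [phi] would force [- 4 e^3 = 0]. Invertibility is needed because [invmx] returns a
    singular matrix unchanged. *)
Lemma disc_normal_form_unit (p : bipoly R) (phi : 'M[R]_2) (e : R) :
  p \in Hpoly R 3 -> e != 0 ->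
  (forall x y, peval p (phi *m vec (x, y)) = x * (x ^+ 2 + e * y ^+ 2)) ->
  phi \in unitmx.
Proof.
move=> hp e0 /(disc_normal_form hp) H; rewrite unitmxE unitfE.
apply: contra_neq e0 => d0; move: H; rewrite d0 expr0n mulr0 => /eqP.
by rewrite eq_sym mulNr oppr_eq0 mulf_eq0 pnatr_eq0 /= expf_eq0 => /eqP.
Qed.

(** Cubing produces [\det phi ^- 6], which [disc_normal_form] expresses through [disc p], and
    postpones real cube roots. *)
Lemma det_gram_inv_cube (p : bipoly R) (phi : 'M[R]_2) (e c : R) :
  p \in Hpoly R 3 -> e != 0 ->
  (forall x y, peval p (phi *m vec (x, y)) = x * (x ^+ 2 + e * y ^+ 2)) ->
  \det (c *: ((invmx phi)^T *m invmx phi)) ^+ 3 = - c ^+ 6 * disc p / (4 * e ^+ 3).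
Proof.
move=> hp e0 H; have := disc_normal_form_unit hp e0 H.
rewrite unitmxE unitfE => d0; have eD := disc_normal_form hp H.
rewrite det_gram det_inv.
have -> : disc p = - 4 * e ^+ 3 / \det phi ^+ 6 by rewrite -eD mulfK ?expf_neq0.
by field; rewrite d0 e0.
Qed.

(* [|pi| <= 1] on the ellipse of [c (phi^-1)^T phi^-1] reduces, by homogeneity,
   to [pi(phi w)^2 <= c^3 |w|^6]. *)
Lemma ellipse_sub_Lambda_normal (p : bipoly R) (phi : 'M[R]_2) (e c : R) :
  0 < c -> phi \in unitmx ->
  (forall x y, peval p (phi *m vec (x, y)) = x * (x ^+ 2 + e * y ^+ 2)) ->
  (forall x y,
    (x * (x ^+ 2 + e * y ^+ 2)) ^+ 2 <= c ^+ 3 * (x ^+ 2 + y ^+ 2) ^+ 3) ->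
  ellipse (c *: ((invmx phi)^T *m invmx phi)) `<=` Lambda p.
Proof.
move=> c0 phiu H le z /ellipse_gramE; rewrite /Lambda /=.
set w := invmx phi *m vec z; set x := w i0 _; set y := w i1 _ => h1.
have -> : vec z = phi *m vec (x, y) by rewrite -vec_surj mulKVmx.
rewrite H -ler_sqr ?nnegrE // real_normK ?num_real // expr1n.
apply: le_trans (le x y) _; rewrite -exprMn exprn_ile1 //.
by rewrite mulr_ge0 ?addr_ge0 ?sqr_ge0 // ltW.
Qed.

(** * Maximal ellipses for quadratic forms and for cubics of either discriminant sign *)

Lemma quad_max_ellipse (p : bipoly R) (U : 'M[R]_2) (l1 l2 : R) :
  p \in Hpoly R 2 -> quad_det p != 0 -> U^T *m U = 1%:M ->
  quad_mx p = U^T *m mx22 l1 0 0 l2 *m U ->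
  defines_max_ellipse (U^T *m mx22 `|l1| 0 0 `|l2| *m U) (Lambda p).
Proof.
move=> hp d0 UU eq.
have dU : \det U ^+ 2 = 1 by rewrite expr2 -{1}det_tr -det_mulmx UU det1.
have dq : quad_det p = l1 * l2.
  by rewrite -det_quad_mx eq !det_mulmx det_tr mulrAC -expr2 dU det2 !mxE /=; ring.
pose M : 'M[R]_2 := mx22 (Num.sqrt `|l1|) 0 0 (Num.sqrt `|l2|) *m U.
have eh : U^T *m mx22 `|l1| 0 0 `|l2| *m U = 1 *: (M^T *m M).
  rewrite scale1r /M trmx_mul -!mulmxA; congr (_ *m _).
  rewrite mulmxA; congr (_ *m _).
  apply/matrixP => i j; rewrite !mxE !big_ord_recl big_ord0 !mxE /=.
  by case: ifP => _; case: ifP => _;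
    rewrite ?mulr0 ?mul0r ?addr0 ?add0r // -expr2 sqr_sqrtr.
have dM : \det M ^+ 2 = `|quad_det p|.
  rewrite /M det_mulmx exprMn dU mulr1 det2 !mxE /= mulr0 subr0 exprMn.
  by rewrite !sqr_sqrtr // dq normrM.
have Mu : M \in unitmx.
  by rewrite unitmxE unitfE -sqrf_eq0 dM normr_eq0.
apply: defines_max_ellipseP.
- by rewrite eh; exact: sym_posdef_gram.
- move=> z; rewrite /ellipse /Lambda /= -(quad_mxE _ hp).2 eq.
  have E a b : dot (U^T *m mx22 a 0 0 b *m U *m vec z) (vec z) =
      a * (U *m vec z) i0 ord0 ^+ 2 + b * (U *m vec z) i1 ord0 ^+ 2.
    rewrite -!mulmxA /dot trmx_mul trmxK -mulmxA.
    rewrite (vec_surj (U *m vec z)) mulmx_vec -/(dot _ _) dot_vec !mxE /=; ring.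
  (* In the coordinates [U z] this is [|l1 X + l2 Y| <= |l1| X + |l2| Y] for squares [X], [Y]. *)
  rewrite !E; apply: le_trans; apply: le_trans (ler_normD _ _) _.
  by rewrite (normrM l1) (normrM l2) !(ger0_norm (sqr_ge0 _)).
move=> h' sh' hL; rewrite eh det_gram expr1n mul1r dM.
exact: quad_inscribed_det.
Qed.

Lemma cubic_max_ellipse_disc_gt0 (p : bipoly R) (phi : 'M[R]_2) :
  p \in Hpoly R 3 -> 0 < disc p ->
  (forall x y : R,
    peval p (phi *m vec (x, y)) = x * (x ^+ 2 - 3 * y ^+ 2)) ->
  let h := (invmx phi)^T *m invmx phi in
  defines_max_ellipse h (Lambda p) /\
  \det h = (2 `^ (- (2 / 3))) / 3 * (disc p) `^ (1 / 3).
Proof.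
move=> hp d0 H0 h.
have H x y : peval p (phi *m vec (x, y)) = x * (x ^+ 2 + (- 3) * y ^+ 2).
  by rewrite H0 mulNr.
have e0 : - 3 != 0 :> R by rewrite oppr_eq0 pnatr_eq0.
have phiu := disc_normal_form_unit hp e0 H.
have -> : h = 1 *: h by rewrite scale1r.
have h3 : \det (1 *: h) ^+ 3 = disc p / 108.
  by rewrite (det_gram_inv_cube _ hp e0 H); field.
have sh : sym_posdef (1 *: h) by apply: sym_posdef_gram; rewrite ?unitmx_inv.
have [_ _ _ dh _] := sym_posdef_entries sh.
split.
  apply: defines_max_ellipseP => //.
    apply: ellipse_sub_Lambda_normal H _ => // x y; rewrite -subr_ge0.
    (* For [z = x + i y] this is [|z^3|^2 - (Re z^3)^2 = (Im z^3)^2]. *)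
    have -> : 1 ^+ 3 * (x ^+ 2 + y ^+ 2) ^+ 3 - (x * (x ^+ 2 + -3 * y ^+ 2)) ^+ 2 =
      (y * (3 * x ^+ 2 - y ^+ 2)) ^+ 2 by ring.
    exact: sqr_ge0.
  move=> h' sh' hL; have [_ _ _ dh' _] := sym_posdef_entries sh'.
  (* By [h3], [disc p] is [108 * \det h ^+ 3], so this bound compares the cubes of the
     determinants. *)
  have /andP[_ ub] := cubic_inscribed_det hp sh' hL.
  by rewrite -(ler_pXn2r (n := 3)) ?nnegrE ?(ltW dh) ?(ltW dh') // h3; lra.
(* Both sides have cube [disc p / 108]. *)
apply: cube_inj; [exact: ltW| |].
  by rewrite !mulr_ge0 ?powR_ge0 ?invr_ge0.
rewrite h3 !exprMn powR13K ?ltW // -powR_mulrn ?powR_ge0 // -powRrM mulNr divfK //.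
by rewrite powRN powR_mulrn //; field.
Qed.

Lemma cubic_max_ellipse_disc_lt0 (p : bipoly R) (phi : 'M[R]_2) :
  p \in Hpoly R 3 -> disc p < 0 ->
  (forall x y : R,
    peval p (phi *m vec (x, y)) = x * (x ^+ 2 + 3 * y ^+ 2)) ->
  let h := (2 `^ (1 / 3)) *: ((invmx phi)^T *m invmx phi) in
  defines_max_ellipse h (Lambda p) /\
  \det h = 1 / 3 * `|disc p| `^ (1 / 3).
Proof.
move=> hp d0 H h.
have e0 : 3 != 0 :> R by rewrite pnatr_eq0.
have phiu := disc_normal_form_unit hp e0 H.
have c0 : 0 < 2 `^ (1 / 3) :> R by rewrite powR_gt0.
have c3 : (2 `^ (1 / 3)) ^+ 3 = 2 :> R by rewrite powR13K.
have h3 : \det h ^+ 3 = - disc p / 27.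
  by rewrite (det_gram_inv_cube _ hp e0 H) (exprM _ 3 2) c3; field.
have sh : sym_posdef h by apply: sym_posdef_gram; rewrite ?unitmx_inv.
have [_ _ _ dh _] := sym_posdef_entries sh.
split.
  apply: defines_max_ellipseP => //.
    apply: ellipse_sub_Lambda_normal H _ => // x y; rewrite c3 -subr_ge0.
    have -> : 2 * (x ^+ 2 + y ^+ 2) ^+ 3 - (x * (x ^+ 2 + 3 * y ^+ 2)) ^+ 2 =
      (x ^+ 2 - y ^+ 2) ^+ 2 * (x ^+ 2 + 2 * y ^+ 2) by ring.
    by rewrite mulr_ge0 ?addr_ge0 ?sqr_ge0 // mulr_ge0 ?sqr_ge0.
  move=> h' sh' hL; have [_ _ _ dh' _] := sym_posdef_entries sh'.
  have /andP[lb _] := cubic_inscribed_det hp sh' hL.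
  by rewrite -(ler_pXn2r (n := 3)) ?nnegrE ?(ltW dh) ?(ltW dh') // h3; lra.
apply: cube_inj; [exact: ltW| |].
  by rewrite mulr_ge0 ?powR_ge0 ?divr_ge0.
by rewrite h3 exprMn powR13K // ltr0_norm //; field.
Qed.

End Ellipses.

Theorem proposition4p2 (R : realType) :
  [/\ (forall (p : bipoly R) (U : 'M[R]_2) (l1 l2 : R),
         p \in Hpoly R 2 -> quad_det p != 0 ->
         U^T *m U = 1%:M ->
         quad_mx p = U^T *m mx22 l1 0 0 l2 *m U ->
         defines_max_ellipse (U^T *m mx22 `|l1| 0 0 `|l2| *m U) (Lambda p)),
      (forall (p : bipoly R) (phi : 'M[R]_2),
         p \in Hpoly R 3 -> 0 < disc p ->
         (forall x y : R,
            peval p (phi *m vec (x, y)) = x * (x ^+ 2 - 3 * y ^+ 2)) ->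
         let h := (invmx phi)^T *m invmx phi in
         defines_max_ellipse h (Lambda p) /\
         \det h = (2 `^ (- (2 / 3))) / 3 * (disc p) `^ (1 / 3)) &
      (forall (p : bipoly R) (phi : 'M[R]_2),
         p \in Hpoly R 3 -> disc p < 0 ->
         (forall x y : R,
            peval p (phi *m vec (x, y)) = x * (x ^+ 2 + 3 * y ^+ 2)) ->
         let h := (2 `^ (1 / 3)) *: ((invmx phi)^T *m invmx phi) in
         defines_max_ellipse h (Lambda p) /\
         \det h = 1 / 3 * `|disc p| `^ (1 / 3))].
Proof.
split.
- exact: quad_max_ellipse.
- exact: cubic_max_ellipse_disc_gt0.
- exact: cubic_max_ellipse_disc_lt0.
Qed.
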